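(* Let $q\ge3$ be a prime power, $\tau\ge0$, and $\epsilon\in(0,1)$ small. Let $(\hat\gamma,\hat\kappa)$, with $\hat\gamma\in[0,q-1)$, $\hat\kappa\in[0,\frac{q-1}{q})$ and $\hat\gamma+\hat\kappa=\tau$, maximize $(2\gamma-\kappa+1)H_q\!\left(\frac{\gamma}{2\gamma-\kappa+1}\right)-\gamma\log_q(q-1)+H_q(\kappa)$ over $\gamma\in[0,q-1)$, $\kappa\in[0,\frac{q-1}{q})$ with $\gamma+\kappa=\tau$. Then for all sufficiently large $n$, with probability at least $1-q^{-n}$, a random $\mathbb{F}_q$-linear insdel code $\mathcal{C}\subseteq\mathbb{F}_q^n$ of rate $$R=1-(2\hat\gamma-\hat\kappa+1)H_q\!\left(\frac{\hat\gamma}{2\hat\gamma-\hat\kappa+1}\right)+\hat\gamma\log_q(q-1)-H_q(\hat\kappa)-\epsilon$$ is $(\tau n,\exp(O(1/\epsilon)))$-list-decodable.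
   Context: The alphabet is the finite field $\mathbb{F}_q$. The insdel distance $d(\mathbf a,\mathbf b)$ between words (lengths may differ) is the minimum number of single-symbol insertions and deletions needed to transform $\mathbf a$ into $\mathbf b$. For $\mathbf u\in\mathbb{F}_q^n$ and real $z\ge0$, $\mathcal{B}(\mathbf u,z)=\{\mathbf v\in\bigcup_{i=\max\{n-z,0\}}^{n+z}\mathbb{F}_q^i: d(\mathbf u,\mathbf v)\le z\}$. A code $\mathcal{C}\subseteq\mathbb{F}_q^n$ is $(\tau n,L)$-list-decodable if for every nonnegative integer $m\in[\max(0,n-\tau n),n+\tau n]$ and every $\mathbf r\in\mathbb{F}_q^m$, $|\mathcal{B}(\mathbf r,\tau n)\cap\mathcal{C}|\le L$. A random $\mathbb{F}_q$-linear code of rate $R$ is the $\mathbb{F}_q$-span of $Rn$ linearly independent vectors chosen uniformly at random from $\mathbb{F}_q^n$. $H_q(x)=x\log_q(q-1)-x\log_qx-(1-x)\log_q(1-x)$ for $0<x<1$, $H_q(0)=H_q(1)=0$. *)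

(* Defs.v *)
From HB Require Import structures.
From mathcomp Require Import all_boot all_order all_algebra all_field.
From mathcomp Require Import all_classical all_reals all_analysis.
Set Implicit Arguments. Unset Strict Implicit. Unset Printing Implicit Defensive.
Import Order.TTheory GRing.Theory Num.Theory.
Local Open Scope ring_scope.

Section Insdel.
Variable T : Type.

Definition insdel_step (a b : seq T) : Prop :=
  exists (x y : seq T) (c : T),
    (a = x ++ c :: y /\ b = x ++ y) \/ (a = x ++ y /\ b = x ++ c :: y).

Fixpoint insdel_within (k : nat) (a b : seq T) : Prop :=
  match k with
  | 0 => a = b
  | k'.+1 => a = b \/ exists c, insdel_step a c /\ insdel_within k' c b
  end.
End Insdel.

(* d(u,v) <= z for real z, i.e. v \in B(u,z)
   (the length condition of B(u,z) is implied by d(u,v) <= z). *)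
Definition in_insdel_ball (R : realType) (T : Type) (u v : seq T) (z : R) : Prop :=
  exists k : nat, (k%:R <= z) /\ insdel_within k u v.

Definition logq (R : realType) (q : nat) (x : R) : R := ln x / ln (q%:R).

Definition Hq (R : realType) (q : nat) (x : R) : R :=
  if (0 < x) && (x < 1) then
    x * logq q (q.-1)%:R - x * logq q x - (1 - x) * logq q (1 - x)
  else 0.

Definition insdel_obj (R : realType) (q : nat) (g k : R) : R :=
  (2 * g - k + 1) * Hq q (g / (2 * g - k + 1)) - g * logq q (q.-1)%:R + Hq q k.

Definition rv2seq (F : Type) (n : nat) (v : 'rV[F]_n) : seq F :=
  [seq v ord0 i | i <- enum 'I_n].

Definition list_decodable (R : realType) (F : finFieldType) (n : nat)
    (C : {set 'rV[F]_n}) (z : R) (L : nat) : Prop :=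
  forall (m : nat) (r : seq F), size r = m ->
    n%:R - z <= m%:R -> m%:R <= n%:R + z ->
    (#|[set c in C | `[< in_insdel_ball r (rv2seq c) z >]]| <= L)%N.

Definition row_code (F : finFieldType) (k n : nat) (G : 'M[F]_(k, n))
  : {set 'rV[F]_n} := [set u *m G | u : 'rV[F]_k].

Definition prob_random_linear (R : realType) (F : finFieldType) (k n : nat)
    (P : {set 'rV[F]_n} -> Prop) : R :=
  #|[set G : 'M[F]_(k, n) | (\rank G == k) && `[< P (row_code G) >]]|%:R
  / #|[set G : 'M[F]_(k, n) | \rank G == k]|%:R.

(* Main.v *)
Require Import Defs.
From HB Require Import structures.
From mathcomp Require Import all_boot all_order all_algebra all_field.
From mathcomp Require Import all_classical all_reals all_analysis.
From mathcomp Require Import ring lra zify.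
Import Order.TTheory GRing.Theory Num.Theory.
Set Implicit Arguments. Unset Strict Implicit. Unset Printing Implicit Defensive.
Local Open Scope ring_scope.

(** A word c of length n in the insdel ball of r shares with r a common
subsequence s; with k = n - |s| and g = |r| - |s| one has g + k <= tau n.
There are at most 'C(|r|, g) choices of s, and the number of words of length n
above s depends only on |s|. Bounding the two counts by product weights with
kappa = k / n and gamma = tau - kappa gives the objective function at
(gamma, kappa), so the ball meets F^n in at most (n + 1) q^(n M) words, where M
is the maximum of the objective.

If the list size exceeds q^l, some ball contains the images of l + 1 linearly
independent messages. For a uniform generator matrix G these images are
independent and uniform, so the union bound over the centre and the messages
gives failure probability at most
(2n + 1) q^(2n) ((n + 1) q^(- eps n))^(l + 1), which is small once l + 1 exceeds
10 / eps. Conditioning on full rank costs a factor 2.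

If the rate is positive then M < 1, which forces tau < (q - 1) / q because H_q
tends to 1 at (q - 1) / q; so every nonnegative pair with sum tau is admissible
in the maximization. If the rate is not positive the code is zero. *)

(** * Common subsequences *)

(** Write [s] as a mask of the longer word and drop the mask bit at [e]: at most one letter is
    lost. *)
Lemma subseq_delete (T : eqType) (s x y : seq T) (e : T) :
  subseq s (x ++ e :: y) ->
  exists s', [/\ subseq s' (x ++ y), subseq s' s & (size s <= (size s').+1)%N].
Proof.
move=> /subseqP[b szb ->].
have sb1 : size (take (size x) b) = size x.
  by rewrite size_takel // szb size_cat leq_addr.
rewrite -(cat_take_drop (size x) b) mask_cat //.
case E : (drop (size x) b) => [|e0 b2].
  move: (f_equal size E); rewrite size_drop szb size_cat /=; lia.
exists (mask (take (size x) b) x ++ mask b2 y); split.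
- by apply: cat_subseq; apply: mask_subseq.
- by apply: cat_subseq => //; case: e0 {E} => //=; apply: subseq_cons.
- by rewrite !size_cat; case: e0 {E} => /=; lia.
Qed.

(** Induction on the steps. If [a] is longer than its successor, [s] is kept; if it is shorter, [s]
    loses at most one letter, and the shorter length of [a] makes up for one of the two units lost
    in [(size s).*2]. *)
Lemma insdel_within_common_subseq (T : eqType) k (a b : seq T) :
  insdel_within k a b ->
  exists s, [/\ subseq s a, subseq s b & (size a + size b <= k + (size s).*2)%N].
Proof.
elim: k a => [|k IH] a /=.
  by move=> ->; exists b; split => //; lia.
case=> [->|[c [[x [y [e H]]] /IH[s [sc sb sz]]]]].
  by exists b; split => //; lia.
case: H => -[Ea Ec].
- exists s; split => //.
    by rewrite Ea; apply: subseq_trans sc _; rewrite Ec cat_subseq // subseq_cons.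
  by move: sz; rewrite Ea Ec !size_cat /=; lia.
- rewrite Ec in sc sz.
  have [s' [s'a s's sz']] := subseq_delete sc.
  exists s'; split; rewrite ?Ea //; first exact: subseq_trans s's sb.
  by move: sz; rewrite !size_cat /=; lia.
Qed.

Lemma sum_tuple_cons (R : nmodType) (T : finType) n (f : n.+1.-tuple T -> R) :
  \sum_(t : n.+1.-tuple T) f t
  = \sum_(h : T) \sum_(t : n.-tuple T) f [tuple of h :: t].
Proof.
rewrite pair_big /= (reindex (fun p : T * n.-tuple T => [tuple of p.1 :: p.2])) //=.
exists (fun t => (thead t, [tuple of behead t])) => [[h t] _|t _] /=.
  by congr pair; apply: val_inj.
by rewrite -tuple_eta.
Qed.

(** Embed [s] greedily from the left: the letter that advances the embedding weighs [p] and each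
    other letter [w], for a total of 1. Once [s] is exhausted every letter weighs [w], and
    [#|T|%:R * w <= 1] takes over. *)
Lemma superseq_count (R : realFieldType) (T : finType) (s : seq T) n (p w : R) :
  (size s <= n)%N -> 0 <= p -> 0 <= w -> p + (#|T|.-1)%:R * w = 1 ->
  #|T|%:R * w <= 1 ->
  \sum_(t : n.-tuple T) (subseq s t)%:R * (p ^+ size s * w ^+ (n - size s)) <= 1.
Proof.
move=> szs p0 w0 pw1 qw1; elim: n s szs => [|n IH] [|a s] szs.
- rewrite (eq_bigr (fun=> 1)) => [|t _]; last by rewrite tuple0 /= !expr0 !mulr1.
  by rewrite sumr_const card_tuple.
- by [].
- rewrite sum_tuple_cons /= subn0 expr0.
  apply: (@le_trans _ _ (\sum_(h : T) w)); last by rewrite sumr_const -mulr_natl.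
  apply: ler_sum => h _; have := IH [::] (leq0n _); rewrite /= subn0 expr0 => H.
  rewrite -[leRHS]mulr1 exprS; apply: le_trans (ler_wpM2l w0 H).
  rewrite mulr_sumr le_eqVlt; apply/orP; left; apply/eqP/eq_bigr => t _.
  by rewrite !sub0seq !mul1r.
- rewrite sum_tuple_cons /= (bigD1 a) //= -[leRHS]pw1 subSS; apply: lerD.
    have := IH s szs => H; rewrite -[leRHS]mulr1; apply: le_trans (ler_wpM2l p0 H).
    rewrite mulr_sumr ler_sum // => t _; rewrite eqxx le_eqVlt; apply/orP; left; apply/eqP.
    by rewrite exprS -!mulrA mulrCA.
  have -> : #|T|.-1%:R * w = \sum_(h : T | h != a) w.
    by rewrite sumr_const mulr_natl cardC1.
  apply: ler_sum => h ha; rewrite eq_sym (negbTE ha).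
  have [lt_sn|ge_sn] := ltnP (size s) n; last first.
    rewrite big1 // => t _.
    case: (boolP (subseq _ _)) => [/size_subseq|]; last by rewrite mul0r.
    by rewrite size_tuple /= => ?; lia.
  have := IH (a :: s) lt_sn => H; rewrite -[leRHS]mulr1; apply: le_trans (ler_wpM2l w0 H).
  rewrite mulr_sumr; apply: ler_sum => t _.
  by rewrite /= -(subnSK lt_sn) [w ^+ _.+1]exprS (mulrCA _ w) (mulrCA _ w).
Qed.

(** The weights of all masks sum to [(x + y) ^+ m = 1]; only those with [j] ones are kept. *)
Lemma mask_count (R : realFieldType) m j (x y : R) :
  0 <= x -> 0 <= y -> x + y = 1 ->
  \sum_(b : m.-tuple bool) (count id b == j)%:R * (x ^+ (m - j) * y ^+ j) <= 1.
Proof.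
move=> x0 y0 xy1.
have S1 : \sum_(b : m.-tuple bool) x ^+ (m - count id b) * y ^+ count id b = 1.
  elim: m => [|m IH].
    rewrite (eq_bigr (fun=> 1)) => [|t _]; last by rewrite tuple0 /= !expr0 !mulr1.
    by rewrite sumr_const card_tuple.
  rewrite sum_tuple_cons /= big_bool /= -xy1 -[x in RHS]mulr1 -[y in RHS]mulr1.
  rewrite addrC -IH !mulr_sumr; congr (_ + _); apply: eq_bigr => b _.
    by rewrite subSn ?exprS ?mulrA // -[leqRHS](size_tuple b) count_size.
  by rewrite subSS add1n exprS mulrCA.
rewrite -[leRHS]S1; apply: ler_sum => b _; case: eqP => [->|_]; first by rewrite mul1r.
by rewrite mul0r mulr_ge0 // exprn_ge0.
Qed.

(** * Entropy estimates *)

Section Entropy.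
Variable R : realType.

(** Since [x <= 1], a smaller exponent gives a larger power. By the convention [ln 0 = 0] the left
    side is 1 at [x = 0], whence the condition on [g] there. *)
Lemma expR_ln_le_exprn (x e : R) (g : nat) :
  0 <= x -> x <= 1 -> (x = 0 -> g = 0%N) -> g%:R <= e -> expR (e * ln x) <= x ^+ g.
Proof.
move=> x0 x1 xg ge; have [xgt|] := ltP 0 x.
  rewrite -[x in x ^+ g]lnK ?posrE // -expRM_natl ler_expR ler_wnM2r //.
  exact: ln_le0.
move=> xle; have x00 : x = 0 by apply/le_anti/andP.
by rewrite xg // expr0 x00 ln0 // mulr0 expR0.
Qed.

Lemma Hq_ln (q : nat) (x : R) : (1 < q)%N -> 0 <= x -> x < 1 ->
  Hq q x * ln q%:R = x * ln q.-1%:R - x * ln x - (1 - x) * ln (1 - x).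
Proof.
move=> q1 x0 x1; rewrite /Hq x1 andbT /logq.
have lq : ln (q%:R : R) != 0 by rewrite gt_eqF // ln_gt0 // ltr1n.
case: ltP => [_|xle]; first by field.
have -> : x = 0 by apply/le_anti/andP.
by rewrite subr0 ln1 !mul0r mulr0 !subr0.
Qed.

(** The two terms [g * ln q.-1%:R] cancel; what remains matches, factor by factor, the logarithm of
    the weight in [weight_lower_bound]. *)
Lemma insdel_obj_ln (q : nat) (g k : R) : (1 < q)%N -> 0 <= g -> 0 <= k -> k < 1 ->
  insdel_obj q g k * ln q%:R
  = - (g * ln (g / (2 * g - k + 1)) + (1 + g - k) * ln ((1 + g - k) / (2 * g - k + 1)))
    - ((1 - k) * ln (1 - k) + (k * ln k - k * ln q.-1%:R)).
Proof.
move=> q1 g0 k0 k1; rewrite /insdel_obj.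
have A0 : 0 < 2 * g - k + 1 by lra.
have x0 : 0 <= g / (2 * g - k + 1) by rewrite divr_ge0 // ltW.
have x1 : g / (2 * g - k + 1) < 1 by rewrite ltr_pdivrMr //; lra.
have lq : ln (q%:R : R) != 0 by rewrite gt_eqF // ln_gt0 // ltr1n.
rewrite mulrDl mulrBl -mulrA !Hq_ln // mulrA.
have -> : 1 - g / (2 * g - k + 1) = (1 + g - k) / (2 * g - k + 1).
  by field; rewrite gt_eqF.
rewrite /logq; set lx := ln (g / _); set ly := ln ((1 + g - k) / _).
by field; rewrite lq gt_eqF.
Qed.

(** In the expansion above all logarithms but [ln q.-1%:R] are nonpositive, and the second bracket
    alone gives [Hq q k]. *)
Lemma insdel_obj_ge0 (q : nat) (g k : R) : (1 < q)%N -> 0 <= g -> 0 <= k -> k < 1 ->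
  Hq q k <= insdel_obj q g k /\ 0 <= insdel_obj q g k.
Proof.
move=> q1 g0 k0 k1.
have lq : 0 < ln (q%:R : R) by rewrite ln_gt0 // ltr1n.
have lq1 : 0 <= ln (q.-1%:R : R) by rewrite ln_ge0 // ler1n; lia.
have A0 : 0 < 2 * g - k + 1 by lra.
have lx : ln (g / (2 * g - k + 1)) <= 0 by apply/ln_le0; rewrite ler_pdivrMr //; lra.
have ly : ln ((1 + g - k) / (2 * g - k + 1)) <= 0.
  by apply/ln_le0; rewrite ler_pdivrMr //; lra.
have lk : ln k <= 0 by apply/ln_le0; lra.
have lk1 : ln (1 - k) <= 0 by apply/ln_le0; lra.
have h1 : g * ln (g / (2 * g - k + 1)) <= 0 by rewrite mulr_ge0_le0.
have h2 : (1 + g - k) * ln ((1 + g - k) / (2 * g - k + 1)) <= 0.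
  by rewrite mulr_ge0_le0 //; lra.
have h3 : k * ln k <= 0 by rewrite mulr_ge0_le0.
have h4 : (1 - k) * ln (1 - k) <= 0 by rewrite mulr_ge0_le0 //; lra.
have h5 : 0 <= k * ln q.-1%:R by rewrite mulr_ge0.
rewrite -(ler_pM2r lq) Hq_ln // -[0 <= _](ler_pM2r lq) mul0r insdel_obj_ln //.
split; lra.
Qed.

(* The exponent g is only bounded above by gam * n: since x, y <= 1 this
   replaces the monotonicity of the objective function in gam. *)
Lemma weight_lower_bound (q n k g : nat) (gam kap x y : R) :
  (1 < q)%N -> (0 < n)%N -> (k <= n)%N -> kap = k%:R / n%:R -> kap < 1 ->
  0 <= gam -> g%:R <= gam * n%:R ->
  x = gam / (2 * gam - kap + 1) -> y = (1 + gam - kap) / (2 * gam - kap + 1) ->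
  expR (- (n%:R * ln q%:R * insdel_obj q gam kap))
  <= x ^+ g * y ^+ (n - k) * ((1 - kap) ^+ (n - k) * (kap / q.-1%:R) ^+ k).
Proof.
move=> q1 n0 kn kapE kap1 gam0 gle xE yE.
have nR : 0 < (n%:R : R) by rewrite ltr0n.
have kapn : kap * n%:R = k%:R by rewrite kapE mulfVK // gt_eqF.
have kap0 : 0 <= kap by rewrite kapE divr_ge0.
have q1R : (1 : R) <= q.-1%:R by rewrite ler1n; lia.
have A0 : 0 < 2 * gam - kap + 1 by lra.
have nk : ((n - k)%:R : R) = (1 - kap) * n%:R by rewrite natrB // mulrBl mul1r kapn.
(* One summand per power. The exponents of [1 - kap] and [kap / q.-1%:R] match exactly; those of [x]
   and [y] are upper bounds for [g] and [n - k]. *)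
have -> : - (n%:R * ln q%:R * insdel_obj q gam kap)
  = gam * n%:R * ln x + ((1 + gam - kap) * n%:R) * ln y
    + ((1 - kap) * n%:R * ln (1 - kap) + kap * n%:R * ln (kap / q.-1%:R)).
  rewrite -mulrA (mulrC (ln _)) insdel_obj_ln // -xE -yE.
  have -> : kap * n%:R * ln (kap / q.-1%:R) = n%:R * (kap * ln kap - kap * ln q.-1%:R).
    have [kgt|kle] := ltP 0 kap; last first.
      by rewrite (_ : kap = 0); [ring|apply/le_anti/andP].
    by rewrite ln_div ?posrE //; [ring|lra].
  ring.
have x0 : 0 <= x by rewrite xE divr_ge0 // ltW.
have y0 : 0 < y by rewrite yE divr_gt0 //; lra.
rewrite !expRD; apply: ler_pM; rewrite ?mulr_ge0 ?expR_ge0 //; apply: ler_pM; rewrite ?expR_ge0 //.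
- apply: expR_ln_le_exprn => //; first by rewrite xE ler_pdivrMr //; lra.
  move=> /eqP; rewrite xE mulf_eq0 invr_eq0 [X in _ || X]gt_eqF // orbF => /eqP gam00.
  by move: gle; rewrite gam00 mul0r lern0 => /eqP.
- apply: expR_ln_le_exprn => //; first exact: ltW.
  + by rewrite yE ler_pdivrMr //; lra.
  + by move=> y00; rewrite y00 ltxx in y0.
  + by rewrite nk ler_wpM2r //; lra.
- apply: expR_ln_le_exprn => //; first lra.
  + by lra.
  + by move=> ?; exfalso; lra.
  + by rewrite nk.
- apply: expR_ln_le_exprn.
  + by rewrite divr_ge0 //; lra.
  + by rewrite ler_pdivrMr; lra.
  + move=> /eqP; rewrite mulf_eq0 invr_eq0 [X in _ || X]gt_eqF ?orbF; last by lra.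
    by move=> /eqP k00; move: kapn; rewrite k00 mul0r => /esym/eqP; rewrite pnatr_eq0 => /eqP.
  + by rewrite kapn.
Qed.

End Entropy.

(** * Linear algebra counts *)

Lemma card_bigcup_leq (I T : finType) (P : pred I) (A : I -> {set T}) :
  (#|\bigcup_(i | P i) A i| <= \sum_(i | P i) #|A i|)%N.
Proof.
elim/big_rec2: _ => [|i a b _ le_ba]; first by rewrite cards0.
by apply: leq_trans (leq_card_setU _ _) _; rewrite leq_add2l.
Qed.

Section LinearCount.
Variable F : finFieldType.
Local Notation q := #|F|.

(** With [D] a right inverse of [U], translation by [D *m (Y2 - Y1)] carries one fibre into another,
    so all fibres have equal size: [U *m G] is uniform when [G] is. *)
Lemma card_mulmx_fiber l K n (U : 'M[F]_(l, K)) (Y : 'M[F]_(l, n)) :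
  row_free U ->
  (#|[set G : 'M[F]_(K, n) | U *m G == Y]| * q ^ (l * n) = q ^ (K * n))%N.
Proof.
move=> /row_freeP[D UD].
have le_fib (Y1 Y2 : 'M[F]_(l, n)) :
    (#|[set G : 'M[F]_(K, n) | U *m G == Y1]|
     <= #|[set G : 'M[F]_(K, n) | U *m G == Y2]|)%N.
  rewrite -(card_imset _ (addrI (D *m (Y2 - Y1)))); apply: subset_leq_card.
  apply/fintype.subsetP=> G' /imsetP[G + ->]; rewrite inE => /eqP UG.
  by rewrite inE mulmxDr mulmxA UD mul1mx UG subrK.
rewrite -(card_mx F K n) -(sum1_card {: 'M[F]_(K, n)}).
rewrite (partition_big (fun G : 'M[F]_(K, n) => U *m G) predT) //=.
rewrite (eq_bigr (fun=> #|[set G : 'M[F]_(K, n) | U *m G == Y]|)).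
  by rewrite sum_nat_const card_mx mulnC.
by move=> Z _; rewrite sum1dep_card; apply/eqP; rewrite eqn_leq !le_fib.
Qed.

(** This is the independence of the images of [l] independent messages: all fall in [B] with
    probability at most [(#|B| / q ^ n) ^ l]. *)
Lemma card_rows_mulmx_in l K n (U : 'M[F]_(l, K)) (B : {set 'rV[F]_n}) :
  row_free U ->
  (#|[set G : 'M[F]_(K, n) | [forall i, row i (U *m G) \in B]]| * q ^ (l * n)
   <= #|B| ^ l * q ^ (K * n))%N.
Proof.
move=> Ufree; rewrite -sum1dep_card.
rewrite (partition_big (fun G : 'M[F]_(K, n) => U *m G)
          (fun Y => [forall i, row i Y \in B])) //=.
rewrite big_distrl /=.
apply: (@leq_trans (\sum_(Y : 'M[F]_(l, n) | [forall i, row i Y \in B]) q ^ (K * n))%N).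
  apply: leq_sum => Y _; rewrite -(card_mulmx_fiber Y Ufree) leq_mul2r.
  rewrite sum1dep_card subset_leq_card ?orbT //.
  by apply/fintype.subsetP=> G; rewrite !inE => /andP[].
rewrite sum_nat_const leq_mul2r; apply/orP; right.
pose rows (Y : 'M[F]_(l, n)) := [ffun i : 'I_l => row i Y].
have rows_inj : injective rows.
  by move=> Y Z /ffunP eqYZ; apply/row_matrixP=> i; have := eqYZ i; rewrite !ffunE.
rewrite -[l in leqRHS]card_ord -(card_ffun_on 'I_l B) -(card_imset _ rows_inj).
apply/subset_leq_card/fintype.subsetP=> _ /imsetP[Y YB ->].
by apply/ffun_onP=> i; rewrite ffunE; apply: (forallP YB).
Qed.

(** The set [T] lies in the row space of the matrix [A] of its elements, which has [q ^ \rank A]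
    vectors, so the rank exceeds [l]. *)
Lemma exists_row_free_in l K (T : {set 'rV[F]_K}) :
  (q ^ l < #|T|)%N ->
  exists2 U : 'M[F]_(l.+1, K), row_free U & forall i, row i U \in T.
Proof.
move=> ltT; pose A := \matrix_(i < #|T|) (enum_val i : 'rV[F]_K).
have ltA : (l < \rank A)%N.
  have q1 : (1 < q)%N by rewrite finRing_gt1.
  rewrite -(ltn_exp2l _ _ q1); apply: leq_trans ltT _.
  rewrite -[leqRHS]/(#|F| ^ _)%N -[X in (_ ^ X)%N]mul1n -card_mx.
  rewrite -(cardsT 'rV_(\rank A)).
  apply: leq_trans (leq_imset_card (fun v => v *m row_base A) _).
  apply/subset_leq_card/fintype.subsetP=> u uT.
  have : (u <= row_base A)%MS.
    have -> : u = row (enum_rank_in uT u) A by rewrite rowK enum_rankK_in.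
    by rewrite eq_row_base row_sub.
  by case/submxP=> v ->; apply/imsetP; exists v; rewrite ?inE.
have /row_freeP[D AD] := maxrowsub_free A.
pose f := widen_ord ltA.
exists (rowsub f (rowsub (maxrankfun A) A)); last first.
  by move=> i; rewrite !row_rowsub rowK enum_valP.
(* The product of the first [l.+1] rows with the first [l.+1] columns of [D] is a corner of the
   identity. *)
apply/row_freeP; exists (colsub f D); rewrite -mxsub_mul AD.
apply/matrixP=> i j; rewrite !mxE; congr ((_ : bool)%:R).
Qed.

(** Union bound over the nonzero vectors [u] of the left kernel, each killing a fraction [q ^- n] of
    the matrices. *)
Lemma card_not_full_rank K n :
  (#|[set G : 'M[F]_(K, n) | \rank G != K]| * q ^ n <= q ^ K * q ^ (K * n))%N.
Proof.
have sub : [set G : 'M[F]_(K, n) | \rank G != K] \subset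
    \bigcup_(u : 'rV[F]_K | u != 0) [set G : 'M[F]_(K, n) | u *m G == 0].
  apply/fintype.subsetP=> G; rewrite inE -/(row_free G) -kermx_eq0.
  case/rowV0Pn=> u /sub_kermxP uG u0.
  by apply/bigcupP; exists u => //; rewrite inE uG.
apply: (@leq_trans (\sum_(u : 'rV[F]_K | u != 0%R)
    #|[set G : 'M[F]_(K, n) | u *m G == 0%R]| * q ^ n)%N).
  rewrite -big_distrl leq_mul2r; apply/orP; right.
  exact: leq_trans (subset_leq_card sub) (card_bigcup_leq _ _).
rewrite (eq_bigr (fun=> (q ^ (K * n))%N)) => [|u u0]; last first.
  by rewrite -[n in (_ ^ n)%N]mul1n card_mulmx_fiber // /row_free rank_rV u0.
rewrite sum_nat_const leq_mul2r; apply/orP; right.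
by rewrite (leq_trans (max_card _)) // card_mx mul1n.
Qed.

End LinearCount.

(** * Size of insdel balls *)

Section Ball.
Variables (R : realType) (F : finFieldType).
Local Notation q := #|F|.

(** Indexing by masks instead of subsequences may repeat a subsequence, but fits [mask_count]. *)
Definition ball_level n (r : seq F) j : {set 'rV[F]_n} :=
  \bigcup_(b : (size r).-tuple bool | count id b == j)
    [set c | subseq (mask b r) (rv2seq c)].

Lemma size_rv2seq n (c : 'rV[F]_n) : size (rv2seq c) = n.
Proof. by rewrite size_map size_enum_ord. Qed.

Lemma rv2seq_inj n : injective (@rv2seq F n).
Proof.
move=> u v /eq_in_map uv; apply/rowP=> i.
by apply: uv; rewrite mem_enum.
Qed.

Lemma card_superseq_rv n (s : seq F) (p w : R) :
  (size s <= n)%N -> 0 <= p -> 0 <= w -> p + q.-1%:R * w = 1 -> q%:R * w <= 1 ->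
  #|[set c : 'rV[F]_n | subseq s (rv2seq c)]|%:R
    * (p ^+ size s * w ^+ (n - size s)) <= 1.
Proof.
move=> sn p0 w0 pw qw; apply: le_trans (superseq_count sn p0 w0 pw qw).
rewrite -mulr_suml ler_wpM2r ?mulr_ge0 ?exprn_ge0 //.
rewrite -natr_sum ler_nat -big_mkcond /= sum1dep_card.
have szt (c : 'rV[F]_n) : size (rv2seq c) == n by rewrite size_rv2seq.
have tinj : injective (fun c : 'rV[F]_n => Tuple (szt c)).
  by move=> u v [/rv2seq_inj].
rewrite -(card_imset _ tinj) subset_leq_card //.
by apply/fintype.subsetP=> _ /imsetP[c + ->]; rewrite !inE.
Qed.

(** Union bound over masks, multiplying the weights of [mask_count] and [superseq_count]. *)
Lemma card_ball_level n (r : seq F) j (x y p w : R) :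
  (j <= n)%N -> 0 <= x -> 0 <= y -> x + y = 1 ->
  0 <= p -> 0 <= w -> p + q.-1%:R * w = 1 -> q%:R * w <= 1 ->
  #|ball_level n r j|%:R * (x ^+ (size r - j) * y ^+ j * (p ^+ j * w ^+ (n - j))) <= 1.
Proof.
move=> jn x0 y0 xy p0 w0 pw qw.
apply: le_trans (mask_count (size r) j x0 y0 xy).
set X := x ^+ _ * _; set P := p ^+ _ * _.
have X0 : 0 <= X by rewrite mulr_ge0 ?exprn_ge0.
have P0 : 0 <= P by rewrite mulr_ge0 ?exprn_ge0.
rewrite mulrCA -mulr_suml (mulrC X) ler_wpM2r //.
have : (#|ball_level n r j|%:R : R) <= \sum_(b : (size r).-tuple bool | count id b == j)
    #|[set c : 'rV[F]_n | subseq (mask b r) (rv2seq c)]|%:R.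
  by rewrite -natr_sum ler_nat; apply: card_bigcup_leq.
move=> /(ler_wpM2r P0)/le_trans; apply.
rewrite mulr_suml -[leRHS]mulr1 mulr_suml [leLHS]big_mkcond /=; apply: ler_sum => b _.
case: eqP => [bj|_]; last by rewrite mul0r.
rewrite mul1r /P.
have <- : size (mask b r) = j by rewrite size_mask ?size_tuple.
by apply: card_superseq_rv => //; rewrite size_mask ?size_tuple // bj.
Qed.

Lemma card_insdel_ball (tau M : R) n (r : seq F) :
  (1 < q)%N -> (0 < n)%N -> tau < q.-1%:R / q%:R ->
  (forall g k, 0 <= g -> 0 <= k -> k < 1 -> g + k = tau -> insdel_obj q g k <= M) ->
  #|[set c : 'rV[F]_n | `[< in_insdel_ball r (rv2seq c) (tau * n%:R) >]]|%:R
  <= n.+1%:R * expR (n%:R * ln q%:R * M).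
Proof.
move=> q1 n0 tauq objM.
have nR : 0 < (n%:R : R) by rewrite ltr0n.
have qR : 0 < (q%:R : R) by rewrite ltr0n; lia.
have qE : (q%:R : R) = q.-1%:R + 1 by rewrite natr1 prednK //; lia.
have q1R : (1 : R) <= q.-1%:R by rewrite ler1n; lia.
have tau1 : tau * q%:R < q.-1%:R by move: tauq; rewrite ltr_pdivlMr.
(* Here [k] counts the letters of the codeword outside the common subsequence, which has length
   [n - k]. *)
pose Lev (k : 'I_n.+1) := (n - k <= size r)%N &&
  (((size r - (n - k))%:R + k%:R : R) <= tau * n%:R).
have sub : [set c : 'rV[F]_n | `[< in_insdel_ball r (rv2seq c) (tau * n%:R) >]]
    \subset \bigcup_(k | Lev k) ball_level n r (n - k)%N.
  apply/fintype.subsetP=> c; rewrite inE => /asboolP[d [dle /insdel_within_common_subseq]].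
  case=> s [sr sc]; rewrite size_rv2seq => szd.
  have sn : (size s <= n)%N by have := size_subseq sc; rewrite size_rv2seq.
  have sm : (size s <= size r)%N := size_subseq sr.
  have kn : (n - size s < n.+1)%N by rewrite ltnS leq_subr.
  have nnE : (n - (n - size s) = size s)%N by rewrite subKn.
  apply/bigcupP; exists (Ordinal kn).
    rewrite /Lev; set k0 := nat_of_ord _; rewrite -[k0]/(n - size s)%N nnE sm /=; apply: le_trans dle; rewrite -natrD ler_nat.
    have arith (a b : nat) : (a <= n -> a <= b -> b + n <= d + a.*2 ->
      b - a + (n - a) <= d)%N by lia.
    exact: arith.
  set k0 := nat_of_ord _; rewrite -[k0]/(n - size s)%N nnE.
  case/subseqP: (sr) => b szb sE.
  apply/bigcupP; exists (@Tuple _ _ b (introT eqP szb)).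
    by rewrite /= sE size_mask.
  by rewrite inE /= -sE.
have le1 k : Lev k -> (#|ball_level n r (n - k)%N|%:R : R) <= expR (n%:R * ln q%:R * M).
  case/andP=> nkr ktau.
  have kn : (k <= n)%N by rewrite -ltnS ltn_ord.
  pose kap : R := k%:R / n%:R.
  have kapn : kap * n%:R = k%:R by rewrite mulfVK // gt_eqF.
  have kap0 : 0 <= kap by rewrite divr_ge0.
  have kaptau : kap <= tau.
    rewrite -(ler_pM2r nR) kapn; apply: le_trans ktau; by rewrite lerDr.
  have kapq : kap * q%:R < q.-1%:R by apply: le_lt_trans tau1; rewrite ler_pM2r.
  have kap1 : kap < 1 by rewrite -(ltr_pM2r qR); lra.
  pose gam := tau - kap.
  have gam0 : 0 <= gam by rewrite /gam; lra.
  have A0 : 0 < 2 * gam - kap + 1 by lra.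
  pose x := gam / (2 * gam - kap + 1); pose y := (1 + gam - kap) / (2 * gam - kap + 1).
  have gle : (size r - (n - k))%:R <= gam * n%:R by rewrite /gam mulrBl kapn; lra.
  have := weight_lower_bound q1 n0 kn (erefl kap) kap1 gam0 gle (erefl x) (erefl y).
  have w0 : 0 <= kap / q.-1%:R by rewrite divr_ge0.
  have := @card_ball_level n r (n - k)%N x y (1 - kap) (kap / q.-1%:R) (leq_subr _ _).
  rewrite (subKn kn) => /(_ _ _ _ _ w0) H1 H2.
  have xy : x + y = 1 by rewrite /x /y; field; rewrite gt_eqF.
  have pw : 1 - kap + q.-1%:R * (kap / q.-1%:R) = 1 by field; rewrite gt_eqF //; lra.
  (* The bound [kap <= tau < q.-1%:R / q%:R] enters here, through [kapq]. *)
  have qw : q%:R * (kap / q.-1%:R) <= 1.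
    by rewrite mulrA ler_pdivrMr; [rewrite mulrC; lra|lra].
  have x0 : 0 <= x by rewrite divr_ge0 // ltW.
  have y0 : 0 <= y by rewrite divr_ge0 //; lra.
  have p0 : 0 <= 1 - kap by lra.
  have {}H1 := H1 x0 y0 xy p0 pw qw.
  have obj : insdel_obj q gam kap <= M by apply: objM => //; rewrite subrK.
  have lq : 0 <= n%:R * ln (q%:R : R) by rewrite mulr_ge0 // ln_ge0 // ler1n ltnW.
  apply: (@le_trans _ _ (expR (n%:R * ln q%:R * insdel_obj q gam kap))); last first.
    by rewrite ler_expR ler_wpM2l.
  rewrite -[expR _]invrK -expRN -[leRHS]mul1r ler_pdivlMr ?expR_gt0 //.
  by apply: le_trans H1; rewrite ler_wpM2l.
apply: (@le_trans _ _ (\sum_(k | Lev k) #|ball_level n r (n - k)%N|%:R)).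
  rewrite -natr_sum ler_nat.
  exact: leq_trans (subset_leq_card sub) (card_bigcup_leq _ _).
apply: le_trans (ler_sum _ le1) _.
rewrite sumr_const -[leLHS]mulr_natl ler_wpM2r ?expR_ge0 // ler_nat.
by apply: leq_trans (max_card _) _; rewrite card_ord.
Qed.

End Ball.

(** * Random linear codes *)

Section Random.
Variables (R : realType) (F : finFieldType).
Local Notation q := #|F|.

(** Since [z <= n], every centre has length at most [2 * n] and is a prefix of a word of length
    exactly [2 * n]; this gives the factor [(2 * n).+1%:R * q%:R ^+ (2 * n)]. The message matrices
    number at most [q ^ (K * l.+1)]. *)
Lemma card_not_list_decodable (z Bmax : R) n K l L :
  z <= n%:R -> (q ^ l <= L)%N ->
  (forall r : seq F,
     #|[set c : 'rV[F]_n | `[< in_insdel_ball r (rv2seq c) z >]]|%:R <= Bmax) ->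
  #|[set G : 'M[F]_(K, n) | ~~ `[< list_decodable (row_code G) z L >]]|%:R
    * q%:R ^+ n ^+ l.+1
  <= ((2 * n).+1%:R * q%:R ^+ (2 * n)) * (q%:R ^+ K * Bmax) ^+ l.+1 * q%:R ^+ (K * n).
Proof.
move=> zn qL ballB.
pose Ball r := [set c : 'rV[F]_n | `[< in_insdel_ball r (rv2seq c) z >]].
pose Ev (r : seq F) (U : 'M[F]_(l.+1, K)) :=
  [set G : 'M[F]_(K, n) | [forall i, row i (U *m G) \in Ball r]].
pose rcv (x : 'I_(2 * n).+1 * (2 * n).-tuple F) : seq F := take x.1 x.2.
have sub : [set G : 'M[F]_(K, n) | ~~ `[< list_decodable (row_code G) z L >]]
    \subset \bigcup_x \bigcup_(U | row_free U) Ev (rcv x) U.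
  apply/fintype.subsetP=> G; rewrite inE => /asboolPn nld.
  apply/negPn/negP => nG; apply: nld => m r szr _ mle.
  rewrite leqNgt; apply/negP => ltL.
  have m2n : (m <= 2 * n)%N.
    by rewrite -(ler_nat R) natrM; lra.
  (* Messages are at least as many as their images, so [G] may be rank deficient. *)
  pose T := [set u : 'rV[F]_K | u *m G \in Ball r].
  have ltT : (q ^ l < #|T|)%N.
    apply: leq_ltn_trans qL (leq_trans ltL _).
    apply: leq_trans (leq_imset_card (fun u => u *m G) T).
    apply/subset_leq_card/fintype.subsetP=> c.
    rewrite inE => /andP[/imsetP[u _ ->] uB].
    by apply/imsetP; exists u => //; rewrite !inE; apply/asboolP.
  have [U Ufree UT] := exists_row_free_in ltT.
  have szt : size (r ++ nseq (2 * n - m) 0) == (2 * n)%N.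
    by rewrite size_cat size_nseq szr subnKC.
  move/negP: nG; apply; apply/bigcupP.
  exists (inord m, Tuple szt) => //; apply/bigcupP; exists U => //.
  rewrite inE; apply/forallP=> i.
  rewrite /rcv /= inordK ?ltnS // -szr take_size_cat // row_mul.
  by have := UT i; rewrite inE.
have cardE x U : row_free U ->
    #|Ev (rcv x) U|%:R * q%:R ^+ n ^+ l.+1 <= Bmax ^+ l.+1 * q%:R ^+ (K * n).
  move=> Ufree; have := card_rows_mulmx_in (Ball (rcv x)) Ufree.
  rewrite -(ler_nat R) !natrM !natrX -exprM (mulnC n) => /le_trans; apply.
  by rewrite ler_wpM2r ?exprn_ge0 // lerXn2r ?nnegrE //; apply: le_trans (ballB (rcv x)).
apply: (@le_trans _ _ (\sum_x \sum_(U : 'M[F]_(l.+1, K) | row_free U)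
    #|Ev (rcv x) U|%:R * q%:R ^+ n ^+ l.+1)).
  under eq_bigr do rewrite -mulr_suml.
  rewrite -mulr_suml ler_wpM2r ?exprn_ge0 //.
  under eq_bigr do rewrite -natr_sum.
  rewrite -natr_sum ler_nat; apply: leq_trans (subset_leq_card sub) _.
  apply: leq_trans (card_bigcup_leq _ _) _.
  by apply: leq_sum => x _; apply: card_bigcup_leq.
have B0 : 0 <= Bmax by apply: le_trans (ballB [::]).
set W := Bmax ^+ l.+1 * q%:R ^+ (K * n).
have W0 : 0 <= W by rewrite mulr_ge0 ?exprn_ge0.
apply: (@le_trans _ _ (\sum_(x : 'I_(2 * n).+1 * (2 * n).-tuple F)
    q%:R ^+ K ^+ l.+1 * W)).
  apply: ler_sum => x _; apply: le_trans (ler_sum _ (cardE x)) _.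
  rewrite sumr_const -[leLHS]mulr_natl ler_wpM2r //.
  rewrite -exprM -natrX ler_nat; apply: leq_trans (max_card _) _.
  by rewrite card_mx mulnC.
rewrite sumr_const -[leLHS]mulr_natl card_prod card_ord card_tuple natrM natrX.
by rewrite exprMn /W !mulrA.
Qed.

(** The fraction of rank-deficient matrices is at most [q ^ K / q ^ n <= 1 / q <= 1 / 2]. *)
Lemma card_full_rank_ge K n : (1 < q)%N -> (K < n)%N ->
  q%:R ^+ (K * n) <= 2 * (#|[set G : 'M[F]_(K, n) | \rank G == K]|%:R : R).
Proof.
move=> q1 Kn.
have := card_not_full_rank F K n.
have -> : [set G : 'M[F]_(K, n) | \rank G != K] = ~: [set G | \rank G == K].
  by apply/setP=> G; rewrite !inE.
have := cardsC [set G : 'M[F]_(K, n) | \rank G == K]; rewrite card_mx.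
set a := #|_|; set b := #|_| => ab bq.
have qq : (2 * q ^ K <= q ^ n)%N.
  apply: (@leq_trans (q ^ K.+1)%N); first by rewrite expnS leq_mul2r q1 orbT.
  by rewrite leq_pexp2l //; lia.
have qK : (0 < q ^ K)%N by rewrite expn_gt0; lia.
rewrite -natrX -natrM ler_nat -ab.
have : (b * 2 <= q ^ (K * n))%N.
  rewrite -(leq_pmul2r qK) (mulnC (q ^ _)%N); apply: leq_trans bq.
  by rewrite -mulnA leq_mul2l qq orbT.
by rewrite -ab; lia.
Qed.

End Random.

(** Bad matrices are counted without a rank condition, so that estimates for uniform [G] apply
    directly. *)
Lemma prob_random_linear_ge (R : realType) (F : finFieldType) K n
    (P : {set 'rV[F]_n} -> Prop) (d : R) :
  (0 < #|[set G : 'M[F]_(K, n) | \rank G == K]|)%N ->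
  #|[set G : 'M[F]_(K, n) | ~~ `[< P (row_code G) >]]|%:R
    <= d * #|[set G : 'M[F]_(K, n) | \rank G == K]|%:R ->
  1 - d <= prob_random_linear R K P.
Proof.
set S := [set G : 'M[F]_(K, n) | \rank G == K] => S0 badle.
rewrite /prob_random_linear -/S ler_pdivlMr ?ltr0n // mulrBl mul1r lerBlDl.
apply: (@le_trans _ _ (#|[set G : 'M[F]_(K, n) | ~~ `[< P (row_code G) >]]|%:R
  + #|[set G : 'M[F]_(K, n) | (\rank G == K) && `[< P (row_code G) >]]|%:R)); last first.
  by rewrite lerD2r.
rewrite -natrD ler_nat; apply: leq_trans (leq_card_setU _ _).
apply/subset_leq_card/fintype.subsetP=> G; rewrite finset.in_setU !finset.in_set => ->.
exact: orNb.
Qed.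

(** * Entropy near its maximum and the bound on the radius *)

Section HqLimit.
Variable R : realType.

(* The left-hand side is the relative entropy of (k, 1 - k) with respect to
   ((q-1)/q, 1/q), estimated term by term with ln t <= t - 1. *)
Lemma Hq_near_max (q : nat) (k d : R) :
  (2 <= q)%N -> 0 < k -> k < 1 -> k = q.-1%:R / q%:R - d ->
  (1 - Hq q k) * ln q%:R <= d ^+ 2 * q%:R ^+ 2.
Proof.
move=> q2 k0 k1 kE.
have qR : (2 : R) <= q%:R by rewrite ler_nat.
have qE : (q.-1%:R : R) = q%:R - 1 by rewrite -subn1 natrB //; lia.
have lnle (t : R) : 0 < t -> ln t <= t - 1.
  by move=> t0; have := @le_ln1Dx R (t - 1); rewrite (addrC 1 (t - 1)) subrK; apply; lra.
rewrite mulrBl mul1r (Hq_ln q2 (ltW k0) k1).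
set Q := q%:R in qR qE kE *.
have kpos : 0 < k * Q / (Q - 1) by rewrite divr_gt0 ?mulr_gt0 //; lra.
have k1pos : 0 < (1 - k) * Q by rewrite mulr_gt0 //; lra.
have := lnle _ kpos; have := lnle _ k1pos.
rewrite ln_div ?posrE ?mulr_gt0 ?lnM ?posrE //; try lra.
rewrite qE => h1 h2.
have := ler_wpM2l (ltW k0) h2; have k1' : 0 <= 1 - k by lra.
have := ler_wpM2l k1' h1 => {}h1 {}h2.
(* Linearizing the logarithms turns the relative entropy into the chi-square divergence. *)
have e1 : k * (k * Q / (Q - 1) - 1) + (1 - k) * ((1 - k) * Q - 1) = d ^+ 2 * Q * (Q / (Q - 1)).
  by rewrite kE qE; field; lra.
have h3 : d ^+ 2 * Q * (Q / (Q - 1)) <= d ^+ 2 * Q ^+ 2.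
  have dQ : 0 <= d ^+ 2 * Q by rewrite mulr_ge0 ?sqr_ge0 //; lra.
  rewrite [Q ^+ 2]expr2 (mulrA (d ^+ 2) Q Q) (ler_wpM2l dQ) //.
  by rewrite ler_pdivrMr; [nra|lra].
apply: le_trans h3; rewrite -e1; apply: le_trans (lerD h2 h1).
by rewrite le_eqVlt; apply/orP; left; apply/eqP; ring.
Qed.

(** Otherwise [k] can be taken just below [q.-1%:R / q%:R] with [g = tau - k]; the objective is at
    least [Hq q k], which is close to 1 and so exceeds [M]. *)
Lemma radius_lt_of_obj_lt1 (q : nat) (tau M : R) :
  (2 <= q)%N ->
  (forall g k, 0 <= g -> g < q.-1%:R -> 0 <= k -> k < q.-1%:R / q%:R ->
     g + k = tau -> insdel_obj q g k <= M) ->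
  tau < q.-1%:R + q.-1%:R / q%:R -> M < 1 -> tau < q.-1%:R / q%:R.
Proof.
move=> q2 objM tauub M1; rewrite ltNge; apply/negP => letau.
have qR : (2 : R) <= q%:R by rewrite ler_nat.
have qE : (q.-1%:R : R) = q%:R - 1 by rewrite -subn1 natrB //; lia.
have lq : 0 < ln (q%:R : R) by rewrite ln_gt0 // ltr1n.
set k0 := q.-1%:R / q%:R in objM tauub letau.
have k00 : 0 < k0 by rewrite divr_gt0 ?qE //; lra.
have k01 : k0 < 1 by rewrite ltr_pdivrMr ?qE //; lra.
have qq : 0 < (q%:R : R) ^+ 2 by rewrite exprn_gt0 //; lra.
pose e := (1 - M) * ln q%:R / q%:R ^+ 2.
have e0 : 0 < e by rewrite /e divr_gt0 // mulr_gt0 //; lra.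
(* In order, the bounds ensure [0 < k], [tau - k < q.-1%:R], [d ^+ 2 <= d], and [d < e], which
   contradicts [e <= d ^+ 2]. *)
pose d := Num.min (Num.min (k0 / 2) ((q.-1%:R + k0 - tau) / 2)) (Num.min 1 (e / 2)).
have d0 : 0 < d by rewrite /d !lt_min; apply/andP; split; apply/andP; split; lra.
have [d1 d2 d3 d4] : [/\ d <= k0 / 2, d <= (q.-1%:R + k0 - tau) / 2, d <= 1 & d <= e / 2].
  by split; rewrite /d !ge_min lexx ?orbT.
pose k := k0 - d.
have [k0' k1'] : 0 < k /\ k < 1 by rewrite /k; split; lra.
have near := Hq_near_max q2 k0' k1' (erefl k).
have g0 : 0 <= tau - k by rewrite /k; lra.
have := objM (tau - k) k g0; rewrite subrK.
have -> : tau - k < q.-1%:R by rewrite /k; lra.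
rewrite (ltW k0').
have -> : k < k0 by rewrite /k; lra.
move=> /(_ isT isT isT erefl) obj.
have [HqM _] := insdel_obj_ge0 q2 g0 (ltW k0') k1'.
have : (1 - M) * ln q%:R <= d ^+ 2 * q%:R ^+ 2.
  by apply: le_trans near; rewrite ler_pM2r //; lra.
have dd : d ^+ 2 <= d by rewrite expr2 ler_piMr // ltW.
rewrite -ler_pdivrMr // -/e; lra.
Qed.

End HqLimit.

(** * Dimension zero, numerical bounds and the final assembly *)

Lemma list_decodable_dim0 (R : realType) (F : finFieldType) n (G : 'M[F]_(0, n))
    (z : R) L : (0 < L)%N -> list_decodable (row_code G) z L.
Proof.
move=> L0 m r _ _ _; apply: leq_trans L0.
apply: (@leq_trans #|[set (0 : 'rV[F]_n)]|); last by rewrite cards1.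
apply/subset_leq_card/fintype.subsetP=> c.
rewrite finset.in_set => /andP[/imsetP[u _ ->] _].
by rewrite [u]thinmx0 mul0mx finset.in_set1.
Qed.

(** Square [1 + t <= expR t] at [t = a * n%:R / 2]; the quadratic term already dominates [n]. *)
Lemma natr_succ_le_expR (R : realType) (a : R) n :
  0 < a -> 4 / a ^+ 2 <= n%:R -> n.+1%:R <= expR (a * n%:R).
Proof.
move=> a0; rewrite ler_pdivrMr ?exprn_gt0 // => an.
have -> : a * n%:R = 2%:R * (a * n%:R / 2) by field.
rewrite expRM_natl; apply: (@le_trans _ _ ((1 + a * n%:R / 2) ^+ 2)).
  have n0 : 0 <= (n%:R : R) by [].
  have := ler_wpM2r n0 an; rewrite -natr1.
  have : 0 <= a * n%:R by rewrite mulr_ge0 // ltW.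
  nra.
by rewrite lerXn2r ?nnegrE ?expR_ge0 ?expR_ge1Dx // addr_ge0 // divr_ge0 // mulr_ge0 // ltW.
Qed.

Lemma list_size_bound (R : realType) (q : nat) (eps : R) :
  (1 < q)%N -> 0 < eps ->
  (q ^ Num.truncn (10 / eps) <= Num.truncn (expR (10 * ln q%:R / eps)))%N.
Proof.
move=> q1 eps0.
have qR : 0 < (q%:R : R) by rewrite ltr0n; lia.
have lq : 0 < ln (q%:R : R) by rewrite ln_gt0 // ltr1n.
rewrite truncn_ge_nat ?expR_ge0 // natrX -[q%:R in leLHS]lnK ?posrE // -expRM_natl.
by rewrite ler_expR mulrAC ler_pM2r // truncn_le divr_ge0 // ltW.
Qed.

Lemma natr_double_le_exprn (R : realFieldType) (n q : nat) :
  (0 < n)%N -> (3 <= q)%N -> 2 * (2 * n).+1%:R <= (q%:R ^+ n) ^+ 2 :> R.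
Proof.
move=> n0 q3; have Yn : ((2 * n).+1 <= q ^ n)%N.
  apply: (@leq_trans (3 ^ n)); last by rewrite leq_exp2r.
  by elim: (n) => // i; rewrite expnS; lia.
by rewrite -!natrX -natrM ler_nat expnS expn1 leq_mul //; apply: leq_trans Yn; lia.
Qed.

Theorem mainTheorem8 (R : realType) (F : finFieldType) (tau gh kh : R) :
  (3 <= #|F|)%N -> 0 <= tau ->
  0 <= gh -> gh < (#|F|.-1)%:R ->
  0 <= kh -> kh < (#|F|.-1)%:R / (#|F|)%:R ->
  gh + kh = tau ->
  (forall g k : R, 0 <= g -> g < (#|F|.-1)%:R ->
     0 <= k -> k < (#|F|.-1)%:R / (#|F|)%:R -> g + k = tau ->
     insdel_obj #|F| g k <= insdel_obj #|F| gh kh) ->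
  exists C : R, 0 < C /\
  exists eps0 : R, 0 < eps0 /\
  forall eps : R, 0 < eps -> eps < eps0 ->
  exists N : nat, forall n : nat, (N <= n)%N ->
    let rate := 1 - insdel_obj #|F| gh kh - eps in
    @prob_random_linear R F (Num.truncn (rate * n%:R)) n
      (fun Cd => list_decodable Cd (tau * n%:R) (Num.truncn (expR (C / eps))))
    >= 1 - ((#|F|)%:R ^- n).
Proof.
move=> q3 tau0 gh0 ghq kh0 khq ghk objM.
set q := #|F| in q3 ghq khq objM *.
have q1 : (1 < q)%N by lia.
have qR : (3 : R) <= q%:R by rewrite ler_nat.
have qE : (q.-1%:R : R) = q%:R - 1 by rewrite -subn1 natrB //; lia.
have lq : 0 < ln (q%:R : R) by rewrite ln_gt0 // ltr1n.
have k0lt1 : q.-1%:R / q%:R < 1 :> R by rewrite qE ltr_pdivrMr //; lra.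
(* With this constant the list size is the integer part of [q] to the power [10 / eps]. *)
exists (10 * ln q%:R); split; first by rewrite mulr_gt0.
exists 1; split => // eps eps0 _.
have [_ M0] := insdel_obj_ge0 q1 gh0 kh0 (lt_trans khq k0lt1).
set M := insdel_obj q gh kh in objM M0 *.
have qL := list_size_bound q1 eps0.
set L := Num.truncn (expR _) in qL *; set l := Num.truncn (10 / eps) in qL.
have [rate_le0|rate_gt0] := leP (1 - M - eps) 0.
  exists 0%N => n _ /=.
  have -> : Num.truncn ((1 - M - eps) * n%:R) = 0%N.
    by apply/truncn0Pn; rewrite -ltNge (le_lt_trans _ ltr01) // mulr_le0_ge0.
  have L0 : (0 < L)%N by apply: leq_trans qL; rewrite expn_gt0 (ltnW q1).
  apply: prob_random_linear_ge.
    by apply/card_gt0P; exists 0; rewrite finset.in_set mxrank0.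
  rewrite [X in X%:R <= _](_ : _ = 0%N).
    by rewrite mulr_ge0 // invr_ge0 exprn_ge0.
  apply/eqP; rewrite cards_eq0; apply/eqP/setP=> G.
  by rewrite finset.in_set finset.in_set0 asboolT //; apply: list_decodable_dim0.
have tauq : tau < q.-1%:R / q%:R.
  apply: (@radius_lt_of_obj_lt1 _ _ _ M) => //; last by lra.
  by rewrite -ghk ltrD.
have objM' g k : 0 <= g -> 0 <= k -> k < 1 -> g + k = tau -> insdel_obj q g k <= M.
  by move=> g0 k0 _ gk; apply: objM => //; lra.
(* Half of [eps] absorbs the factor [n.+1] of the ball bound; the other half gives the decay. *)
pose a := eps * ln q%:R / 2.
have a0 : 0 < a by rewrite divr_gt0 // mulr_gt0.
exists (Num.truncn (4 / a ^+ 2)).+1 => n Nn /=.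
have n0 : (0 < n)%N := leq_ltn_trans (leq0n _) Nn.
have nR : 0 < (n%:R : R) by rewrite ltr0n.
have n1exp : n.+1%:R <= expR (a * n%:R).
  apply: natr_succ_le_expR => //; apply/ltW/(lt_le_trans (truncnS_gt _)).
  by rewrite ler_nat.
set K := Num.truncn _.
have Kle : K%:R <= (1 - M - eps) * n%:R by rewrite truncn_le mulr_ge0 // ltW.
have Kn : (K < n)%N.
  rewrite -(ltr_nat R); apply: le_lt_trans Kle _.
  by rewrite -[ltRHS]mul1r ltr_pM2r //; lra.
have q0 : 0 < (q%:R : R) by lra.
have qexp (i : nat) : (q%:R : R) ^+ i = expR (i%:R * ln q%:R).
  by rewrite expRM_natl lnK // posrE.
pose Y := (q%:R : R) ^+ n.
have Y0 : 0 < Y by rewrite exprn_gt0.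
(* Of the five factors [Y], two pay for the words of length [2 * n], two for [2 * (2 * n).+1%:R]
   (lengths and full rank), and the last is the failure probability. *)
have pow : expR (- (a * n%:R)) ^+ l.+1 <= (Y ^+ 5)^-1.
  rewrite /Y -exprM qexp -expRN -expRM_natl ler_expR.
  have : 10 <= l.+1%:R * eps by rewrite -ler_pdivrMr //; apply/ltW/truncnS_gt.
  have nlq : 0 <= n%:R * ln (q%:R : R) by rewrite mulr_ge0 // ltW.
  rewrite natrM /a => /(ler_wpM2r nlq); lra.
have Y2 : 2 * (2 * n).+1%:R <= Y ^+ 2 := natr_double_le_exprn R n0 q3.
have tau1 : tau <= 1 by lra.
have full := @card_full_rank_ge R F K n q1 Kn.
set S := [set G : 'M[F]_(K, n) | \rank G == K] in full.
have S0 : (0 < #|S|)%N.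
  rewrite -(ltr_nat R) -(ltr_pM2l (ltr0n _ 2)) mulr0; apply: lt_le_trans full.
  by rewrite exprn_gt0.
apply: prob_random_linear_ge => //; rewrite -/S.
have ball (r : seq F) := card_insdel_ball r q1 n0 tauq objM'.
have taun : tau * n%:R <= n%:R by rewrite ler_piMl.
have bad := card_not_list_decodable K taun qL ball.
set B := #|_| in bad *.
rewrite -/Y in bad *.
(* The exponents add up to [n * ln q - 2 * a * n + a * n], since [2 * a = eps * ln q]. *)
have step : q%:R ^+ K * (n.+1%:R * expR (n%:R * ln q%:R * M))
    <= Y * expR (- (a * n%:R)).
  rewrite /Y !qexp.
  apply: (@le_trans _ _ (expR ((1 - M - eps) * n%:R * ln q%:R)
      * (expR (a * n%:R) * expR (n%:R * ln q%:R * M)))).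
    rewrite ler_pM ?expR_ge0 ?mulr_ge0 ?expR_ge0 //.
      by rewrite ler_expR ler_pM2r.
    by rewrite ler_wpM2r ?expR_ge0.
  rewrite -!expRD ler_expR le_eqVlt; apply/orP; left; apply/eqP.
  by rewrite /a; field.
have Z0 : 0 <= q%:R ^+ K * (n.+1%:R * expR (n%:R * ln q%:R * M)) :> R.
  by rewrite mulr_ge0 ?exprn_ge0 // mulr_ge0 ?expR_ge0.
have {}step := lerXn2r l.+1 Z0 (le_trans Z0 step) step.
have YE : (q%:R : R) ^+ (2 * n) = Y ^+ 2 by rewrite mulnC exprM.
rewrite YE in bad.
have bad2 : B%:R * Y ^+ l.+1 <= ((2 * n).+1%:R * Y ^+ 2) * (Y ^+ l.+1 * (Y ^+ 5)^-1) * (2 * #|S|%:R).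
  apply: le_trans bad _; apply: ler_pM => //.
    by rewrite !mulr_ge0 ?exprn_ge0 // ltW.
  rewrite ler_wpM2l // ?mulr_ge0 ?exprn_ge0 ?(ltW Y0) //.
  apply: le_trans step _; rewrite exprMn ler_wpM2l // exprn_ge0 // ltW //.
have Yl : 0 < Y ^+ l.+1 by rewrite exprn_gt0.
rewrite -(ler_pM2r Yl); apply: le_trans bad2 _.
have -> : (2 * n).+1%:R * Y ^+ 2 * (Y ^+ l.+1 * (Y ^+ 5)^-1) * (2 * #|S|%:R)
  = (2 * (2 * n).+1%:R) * (Y ^+ l.+1 * #|S|%:R / Y ^+ 3).
  by field; rewrite gt_eqF.
have -> : Y^-1 * #|S|%:R * Y ^+ l.+1 = Y ^+ 2 * (Y ^+ l.+1 * #|S|%:R / Y ^+ 3).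
  by field; rewrite gt_eqF.
have Yge0 := ltW Y0.
by rewrite ler_wpM2r // divr_ge0 ?mulr_ge0 ?exprn_ge0.
Qed.
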